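(* Let $(\mathcal M,g)$ be an oriented, time-oriented smooth Lorentzian surface, and let $(v,w)$ be local coordinates on an open set $\mathcal U\subset\mathcal M$ in which $g=\Omega^2(v,w)(-dv^2+dw^2)$ with $\Omega>0$ smooth, $\partial_v$ future-directed and $(\partial_v,\partial_w)$ positively oriented. Let $(v,w,\chi)$, $\chi\in\mathbb R$, be the coordinates on the orthonormal frame bundle $O(\mathcal M)|_{\mathcal U}$ for which $(v,w,\chi)$ corresponds to the frame at $(v,w)$ $$\tilde E_1=\tfrac1\Omega(\cosh\chi\,\partial_v+\sinh\chi\,\partial_w),\qquad \tilde E_2=\tfrac1\Omega(\sinh\chi\,\partial_v+\cosh\chi\,\partial_w).$$ Then, using the Euclidean inner product, the Schmidt metric $\overline g$ on $O(\mathcal M)|_{\mathcal U}$ built from the Levi-Civita connection of $g$ has line element $$ds^2=\Omega^2(v,w)\big(\cosh(2\chi)\,(dv^2+dw^2)-2\sinh(2\chi)\,dv\,dw\big)+\Big(d\chi+\frac1\Omega\Big(\frac{\partial\Omega}{\partial v}\,dw+\frac{\partial\Omega}{\partial w}\,dv\Big)\Big)^2 .$$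
   Context: $O(\mathcal M)$ is the principal $SO^+(1,1)$-bundle of oriented, time-oriented orthonormal frames $(\tilde E_1,\tilde E_2)$ of $(\mathcal M,g)$, with $\tilde E_1$ future-directed timelike. In local coordinates $x^a$ on $\mathcal M$, a frame has components $\tilde E_b=\beta^a{}_b\,\partial_a$. The solder form is the $\mathbb R^2$-valued 1-form $\theta$ with $\theta^a=\sum_c(\beta^{-1})^a{}_c\,dx^c$. The connection form of the Levi-Civita connection is the matrix-valued 1-form $\varpi$ with $$\varpi^a{}_b=\sum_c\Big((\beta^{-1})^a{}_c\,d\beta^c{}_b+\sum_{d,e}(\beta^{-1})^a{}_c\,\Gamma^c{}_{de}\,\beta^e{}_b\,dx^d\Big),$$ where $\Gamma^c{}_{de}$ are the Christoffel symbols of $g$; both forms are restricted to $O(\mathcal M)$. The Schmidt metric is the Riemannian metric $\overline g(X,Y)=\theta(X)\cdot\theta(Y)+\varpi(X)\bullet\varpi(Y)$ on $O(\mathcal M)$, where $\cdot$ and $\bullet$ are inner products on $\mathbb R^2$ and on $\mathfrak g\cong\mathbb R^{n^2}$ ($n=2$) respectively; here the Euclidean inner product is used.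
   Formalization: The inner product on the Lie algebra is half the Euclidean product on R^4 (the boost generator has unit length); with the literal Euclidean product on R^{n^2} the last square in the line element would carry a factor 2. *)

(* Defs.v *)
From HB Require Import structures.
From mathcomp Require Import all_boot all_order all_algebra.
From mathcomp Require Import all_classical all_reals all_analysis.
From mathcomp Require Import lra.
Set Implicit Arguments.
Unset Strict Implicit.
Unset Printing Implicit Defensive.
Import Order.TTheory GRing.Theory Num.Theory.
Import numFieldNormedType.Exports.
Local Open Scope classical_set_scope.
Local Open Scope ring_scope.

(** ** Calculus in R^2

    Points and tangent vectors of R^2 are column vectors; index 0 is the first
    (timelike) coordinate v, index 1 the second (spacelike) coordinate w. *)

Section Calculus.
Context {R : realType}.
Implicit Types (D : set 'cV[R]_2) (f : 'cV[R]_2 -> R^o).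

Definition cosh (x : R) : R := (expR x + expR (- x)) / 2.
Definition sinh (x : R) : R := (expR x - expR (- x)) / 2.

Definition partial (i : 'I_2) f : 'cV[R]_2 -> R^o :=
  fun x => 'D_(delta_mx i 0) f x.

(* C^infinity: all iterated partial derivatives exist and are
   (Frechet-)differentiable, hence continuous, at every point of D. *)
Definition smooth_on D f : Prop :=
  forall (s : seq 'I_2) (x : 'cV[R]_2), D x ->
    differentiable (foldr partial f s) x.

Definition jacobian2 (tau : 'cV[R]_2 -> 'cV[R]_2) (x : 'cV[R]_2) : 'M[R]_2 :=
  \matrix_(i, j) partial j (fun y => tau y i 0) x.

End Calculus.

(** ** Smooth surfaces *)

(* [chart_point] is the inverse of [chart_coord]; its values outside [cimage]
   are irrelevant. *)
Record chart (R : realType) (M : topologicalType) := Chart {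
  cdom : set M;
  chart_coord : M -> 'cV[R]_2;
  chart_point : 'cV[R]_2 -> M;
  cimage := chart_coord @` cdom;
  cdom_open : open cdom;
  cimage_open : open cimage;
  chart_coordK : forall p, cdom p -> chart_point (chart_coord p) = p;
  chart_coord_continuous : {within cdom, continuous chart_coord};
  chart_point_continuous : {within cimage, continuous chart_point} }.

Section Charts.
Context {R : realType} {M : topologicalType}.
Implicit Types c d : chart R M.

Definition overlap c d : set 'cV[R]_2 := chart_coord c @` (cdom c `&` cdom d).

Definition transition c d : 'cV[R]_2 -> 'cV[R]_2 :=
  chart_coord d \o chart_point c.

Definition compatible c d : Prop := forall i : 'I_2,
  smooth_on (overlap c d) (fun x => transition c d x i 0) /\
  smooth_on (overlap d c) (fun x => transition d c x i 0).

End Charts.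

Record smoothSurface (R : realType) := SmoothSurface {
  surf_space :> topologicalType;
  surf_hausdorff : hausdorff_space surf_space;
  surf_countable : @second_countable surf_space;
  atlas : set (chart R surf_space);
  atlas_cover : forall p, exists2 c, atlas c & cdom c p;
  atlas_compatible : forall c d, atlas c -> atlas d -> compatible c d }.

(* Membership in the maximal atlas. *)
Definition local_coordinates (R : realType) (M : smoothSurface R)
    (c : chart R M) : Prop :=
  forall d, atlas d -> compatible c d.

(** ** Oriented, time-oriented Lorentzian surfaces *)

Section Minkowski.
Context {R : realType}.

Definition minkowski_form : 'M[R]_2 :=
  diag_mx (\row_j (if j == 0 then -1 else 1)).

Definition bilin (g : 'M[R]_2) (X Y : 'cV[R]_2) : R := (X^T *m g *m Y) 0 0.

Definition lorentzian (g : 'M[R]_2) : Prop :=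
  g^T = g /\ exists2 P, P \in unitmx & P^T *m g *m P = minkowski_form.

End Minkowski.

(* Tensor fields are given by their components in all local coordinates,
   subject to the transformation law.  An orientation is represented by a
   nowhere vanishing 2-form [area] = (area c x) dx^0 /\ dx^1, and a time
   orientation by a timelike vector field [time]. *)
Record lorentzSurface (R : realType) := LorentzSurface {
  lsurf :> smoothSurface R;
  metric : chart R lsurf -> 'cV[R]_2 -> 'M[R]_2;
  area : chart R lsurf -> 'cV[R]_2 -> R;
  time : chart R lsurf -> 'cV[R]_2 -> 'cV[R]_2;
  metric_smooth : forall c, local_coordinates c -> forall i j,
    smooth_on (cimage c) (fun x => metric c x i j);
  area_smooth : forall c, local_coordinates c -> smooth_on (cimage c) (area c);
  time_smooth : forall c, local_coordinates c -> forall i,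
    smooth_on (cimage c) (fun x => time c x i 0);
  metric_transform : forall c d, local_coordinates c -> local_coordinates d ->
    forall x, overlap c d x ->
    let J := jacobian2 (transition c d) x in
    metric c x = J^T *m metric d (transition c d x) *m J;
  area_transform : forall c d, local_coordinates c -> local_coordinates d ->
    forall x, overlap c d x ->
    area c x = \det (jacobian2 (transition c d) x) * area d (transition c d x);
  time_transform : forall c d, local_coordinates c -> local_coordinates d ->
    forall x, overlap c d x ->
    time d (transition c d x) = jacobian2 (transition c d) x *m time c x;
  metric_lorentzian : forall c, local_coordinates c ->
    forall x, cimage c x -> lorentzian (metric c x);
  area_neq0 : forall c, local_coordinates c ->
    forall x, cimage c x -> area c x != 0;
  time_timelike : forall c, local_coordinates c ->
    forall x, cimage c x -> bilin (metric c x) (time c x) (time c x) < 0 }.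

(** ** The orthonormal frame bundle and the Schmidt metric *)

Section Frames.
Context {R : realType}.
Variables (M : lorentzSurface R) (c : chart R M).

(* X is timelike and in the same half of the light cone as the time
   orientation. *)
Definition future_timelike (x X : 'cV[R]_2) : Prop :=
  bilin (metric c x) X X < 0 /\ bilin (metric c x) X (time c x) < 0.

(* A pair of tangent vectors is given by the matrix of which they are the
   columns. *)
Definition positively_oriented (x : 'cV[R]_2) (B : 'M[R]_2) : Prop :=
  0 < area c x * \det B.

(* The frame (E_0, E_1) at x with E_b = sum_a B a b * d/dx^a is encoded as
   the pair (x, B); this gives local coordinates on the linear frame bundle. *)
Definition frame_bundle : set ('cV[R]_2 * 'M[R]_2) :=
  [set u | [/\ cimage c u.1,
              u.2^T *m metric c u.1 *m u.2 = minkowski_form,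
              positively_oriented u.1 u.2 &
              future_timelike u.1 (col 0 u.2)]].

Definition christoffel (x : 'cV[R]_2) (k i j : 'I_2) : R :=
  2^-1 * \sum_l invmx (metric c x) k l *
    (partial i (fun y => metric c y l j) x
     + partial j (fun y => metric c y l i) x
     - partial l (fun y => metric c y i j) x).

Implicit Types (u X Y : 'cV[R]_2 * 'M[R]_2).

(* In the next definitions u = (x, B) is a frame and X = (dx, dB) a tangent
   vector at u. *)
Definition solder u X : 'cV[R]_2 :=
  \col_a \sum_k invmx u.2 a k * X.1 k 0.

Definition connection u X : 'M[R]_2 :=
  \matrix_(a, b) \sum_k (invmx u.2 a k * X.2 k b
    + \sum_i \sum_j invmx u.2 a k * christoffel u.1 k i j * u.2 j b * X.1 i 0).

End Frames.

Section LieAlgebra.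
Context {R : realType}.

Definition so11 : set 'M[R]_2 :=
  [set A | A^T *m minkowski_form + minkowski_form *m A = 0].

Definition boost : 'M[R]_2 := \matrix_(i, j) (i != j)%:R.

(* The Euclidean inner product on so(1,1), identified with R by taking the
   boost generator as unit vector (see lie_dotE): it is the Euclidean inner
   product of matrix entries, normalised by |boost| = 1. *)
Definition lie_dot (A B : 'M[R]_2) : R := 2^-1 * \sum_i \sum_j A i j * B i j.

Lemma so11P (A : 'M[R]_2) : so11 A <-> exists a, A = a *: boost.
Proof.
have ord2 (i : 'I_2) : i = 0 \/ i = 1.
  by case: i => -[|[|//]] p; [left|right]; apply/val_inj.
split=> [/matrixP AP|[a ->]]; last first.
  apply/matrixP => i j.
  rewrite !mxE !big_ord_recl !big_ord0 !mxE.
  by case: (ord2 i) => ->; case: (ord2 j) => -> /=; lra.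
have := AP 1 1; have := AP 0 1; have := AP 0 0.
rewrite !mxE !big_ord_recl !big_ord0 !mxE /=.
rewrite (_ : lift _ _ = 1); last exact/val_inj.
move=> A00 A01 A11; exists (A 0 1); apply/matrixP => i j; rewrite !mxE.
by case: (ord2 i) => ->; case: (ord2 j) => -> /=; lra.
Qed.

Lemma lie_dotE (a b : R) : lie_dot (a *: boost) (b *: boost) = a * b.
Proof. by rewrite /lie_dot !big_ord_recl !big_ord0 !mxE /=; lra. Qed.

End LieAlgebra.

Section Schmidt.
Context {R : realType}.
Variables (M : lorentzSurface R) (c : chart R M).

Definition schmidt_metric (u X Y : 'cV[R]_2 * 'M[R]_2) : R :=
  \sum_a solder u X a 0 * solder u Y a 0
  + lie_dot (connection c u X) (connection c u Y).

End Schmidt.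

(** ** The coordinates (v, w, chi)

    A point is q = ((v, w), chi), with v = q.1 0 0, w = q.1 1 0, chi = q.2. *)

Section FrameCoordinates.
Context {R : realType}.
Local Notation E := ('cV[R]_2 * R^o)%type.
Local Notation F := ('cV[R]_2 * 'M[R]_2)%type.
Implicit Types (Phi : E -> F) (p q X Y : E) (a b : E -> R).

Definition frame_coord (Omega : 'cV[R]_2 -> R) : E -> F := fun q =>
  (q.1, (Omega q.1)^-1 *:
        \matrix_(i, j) if i == j then cosh q.2 else sinh q.2).

Definition tangent_map Phi q X : F :=
  (\col_i 'D_X (fun p => (Phi p).1 i 0 : R^o) q,
   \matrix_(i, j) 'D_X (fun p => (Phi p).2 i j : R^o) q).

Definition pullback Phi (h : F -> F -> F -> R) q X Y : R :=
  h (Phi q) (tangent_map Phi q X) (tangent_map Phi q Y).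

Definition dv X : R := X.1 0 0.
Definition dw X : R := X.1 1 0.
Definition dchi X : R := X.2.

(* The symmetric product of 1-forms, as in ds^2 = ... dv dw ... *)
Definition sym_prod a b X Y : R := (a X * b Y + b X * a Y) / 2.

End FrameCoordinates.

(* Main.v *)
(* In the conformal chart the frame with parameter chi is the matrix
   B = Omega^-1 L, where L = exp(chi K) is a Lorentz boost and K its generator;
   every future-directed positively oriented orthonormal frame has this form
   because Omega B preserves the Minkowski form, has positive determinant and
   positive upper left entry.  Differentiating, dB = (dchi K - d(ln Omega)) B,
   while the Christoffel symbols contract to d(ln Omega) + kappa K with
   kappa = d_v(ln Omega) dw + d_w(ln Omega) dv.  The multiples of the identity
   cancel and K commutes with L, so the connection form is (dchi + kappa) K.
   The solder form is Omega L^-1 (dv, dw), whose Euclidean square is computed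
   by the double-angle formulas. *)

Require Import Defs.
From HB Require Import structures.
From mathcomp Require Import all_boot all_order all_algebra.
From mathcomp Require Import all_classical all_reals all_analysis.
From mathcomp Require Import ring lra.
Set Implicit Arguments.
Unset Strict Implicit.
Unset Printing Implicit Defensive.
Import Order.TTheory GRing.Theory Num.Theory.
Import numFieldNormedType.Exports.
Local Open Scope classical_set_scope.
Local Open Scope ring_scope.

(** * Identities and derivatives of the hyperbolic functions *)

Section Hyperbolic.
Context {R : realType}.
Implicit Types x : R.

Lemma coshDsinh x : cosh x + sinh x = expR x.
Proof. by rewrite /cosh /sinh; field. Qed.

(** Factors as (cosh x - sinh x)(cosh x + sinh x) = e^(-x) e^x. *)
Lemma cosh2Bsinh2 x : cosh x ^+ 2 - sinh x ^+ 2 = 1.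
Proof.
rewrite subr_sqr coshDsinh -[RHS](expRxMexpNx_1 x) mulrC; congr (_ * _).
by rewrite /cosh /sinh; field.
Qed.

Lemma cosh_double x : cosh (2 * x) = cosh x ^+ 2 + sinh x ^+ 2.
Proof.
rewrite /cosh /sinh -mulrN !expRM_natl.
by field.
Qed.

Lemma sinh_double x : sinh (2 * x) = 2 * cosh x * sinh x.
Proof.
rewrite /cosh /sinh -mulrN !expRM_natl.
by field.
Qed.

Lemma coshN x : cosh (- x) = cosh x.
Proof. by rewrite /cosh opprK addrC. Qed.

Lemma sinhN x : sinh (- x) = - sinh x.
Proof. by rewrite /sinh opprK; lra. Qed.

Lemma cosh_gt0 x : 0 < cosh x.
Proof. by rewrite divr_gt0 // addr_gt0 ?expR_gt0. Qed.

Lemma is_derive_expRN x :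
  is_derive x 1 (fun y : R => expR (- y)) (- expR (- x)).
Proof.
by have := @is_derive1_comp R expR -%R x (expR (- x)) (- 1) _ _;
  rewrite mulrN1; apply.
Qed.

Lemma is_derive_cosh x : is_derive x 1 (cosh : R -> R) (sinh x).
Proof.
have dN := is_derive_expRN x.
have -> : sinh x = 2^-1 *: (expR x + - expR (- x)) by rewrite /sinh mulrC.
have -> : cosh = 2^-1 *: (expR + (fun y : R => expR (- y))).
  by apply/funext => y; rewrite /cosh mulrC.
exact: is_deriveZ.
Qed.

Lemma is_derive_sinh x : is_derive x 1 (sinh : R -> R) (cosh x).
Proof.
have dN := is_derive_expRN x.
have -> : cosh x = 2^-1 *: (expR x - - expR (- x)) by rewrite /cosh opprK mulrC.
have -> : sinh = 2^-1 *: (expR - (fun y : R => expR (- y))).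
  by apply/funext => y; rewrite /sinh mulrC.
exact: is_deriveZ.
Qed.

End Hyperbolic.

(** * Two-by-two matrices *)

Section Matrix2.
Context {R : realType}.

Lemma ord2P (i : 'I_2) : i = 0 \/ i = 1.
Proof. by case: i => -[|[|//]] p; [left|right]; apply/val_inj. Qed.

Lemma sum_ord2 (V : nmodType) (F : 'I_2 -> V) : \sum_i F i = F 0 + F 1.
Proof.
rewrite !big_ord_recl big_ord0 addr0; congr (_ + F _); exact/val_inj.
Qed.

Lemma mx2P (m : nat) (A B : 'M[R]_(2, m)) :
  (forall j, A 0 j = B 0 j) -> (forall j, A 1 j = B 1 j) -> A = B.
Proof. by move=> h0 h1; apply/matrixP => i j; case: (ord2P i) => ->. Qed.

Lemma det_mx2 (A : 'M[R]_2) : \det A = A 0 0 * A 1 1 - A 0 1 * A 1 0.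
Proof.
have l1 (j : 'I_1) : lift 0 j = 1 :> 'I_2 by rewrite ord1; apply/val_inj.
have l0 (j : 'I_1) : lift 1 j = 0 :> 'I_2 by rewrite ord1; apply/val_inj.
rewrite (expand_det_row _ 0) sum_ord2 /cofactor !det_mx11 !mxE !(l0, l1) /=.
by rewrite expr0 expr1; ring.
Qed.

Lemma invmx_eq n (A B : 'M[R]_n) : A *m B = 1%:M -> invmx A = B.
Proof.
move=> AB; have [uA _] := mulmx1_unit AB.
by rewrite -[invmx A]mulmx1 -AB mulmxA mulVmx// mul1mx.
Qed.

End Matrix2.

(** * Directional derivatives on the plane and on the product with the fibre *)

Section Derivatives.
Context {R : realType}.
Local Notation E := ('cV[R]_2 * R^o)%type.

(** Operations on the product are componentwise, so both sides have the same difference quotient by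
    conversion. *)
Lemma derive_comp_fst (V : normedModType R) (f : 'cV[R]_2 -> V) (q X : E) :
  'D_X (fun p => f p.1) q = 'D_(X.1) f q.1.
Proof. by []. Qed.

Lemma derivable_comp_fst (V : normedModType R) (f : 'cV[R]_2 -> V) (q X : E) :
  derivable f q.1 X.1 -> derivable (fun p => f p.1) q X.
Proof. by []. Qed.

Lemma derivable_comp_snd (V : normedModType R) (f : R^o -> V) (q X : E) :
  derivable f q.2 X.2 -> derivable (fun p => f p.2) q X.
Proof. by []. Qed.

Lemma derive_entry n (i : 'I_n.+1) (x X : 'cV[R]_n.+1) :
  'D_X (fun y : 'cV[R]_n.+1 => y i 0 : R^o) x = X i 0.
Proof.
rewrite /derive; apply: cvg_lim => //.
(* A coordinate is linear, so its difference quotient is constant for h != 0. *)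
apply: cvg_near_cst; near=> h.
rewrite /= !mxE addrK; apply: mulKf.
near: h; exact: nbhs_dnbhs_neq.
Unshelve. all: by end_near. Qed.

Lemma derive_partial (f : 'cV[R]_2 -> R^o) (x X : 'cV[R]_2) :
  differentiable f x ->
  'D_X f x = X 0 0 * partial 0 f x + X 1 0 * partial 1 f x.
Proof.
move=> df; rewrite /partial !deriveE //.
have {1}-> : X = X 0 0 *: delta_mx 0 0 + X 1 0 *: delta_mx 1 0.
  by apply: mx2P => j; rewrite ord1 !mxE /= ?mulr1 ?mulr0 ?addr0 ?add0r.
by rewrite linearD !linearZ.
Qed.

(** Reduces a fibre direction to the unit direction, in which the derivatives of cosh and sinh are
    stated. *)
Lemma derive_scale (f : R^o -> R^o) (x v : R^o) : differentiable f x ->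
  'D_v f x = v * 'D_1 f x.
Proof.
by move=> df; rewrite !deriveE // -[in LHS](mulr1 v) -[v * 1]/(v *: 1) linearZ.
Qed.

End Derivatives.

(** * Lorentz boosts and isometries of the Minkowski form *)

Section LorentzBoost.
Context {R : realType}.
Implicit Types (chi k : R) (B L : 'M[R]_2) (X Y : 'cV[R]_2).

Definition lorentz_boost chi : 'M[R]_2 :=
  \matrix_(i, j) if i == j then cosh chi else sinh chi.

(** The exponential of chi K, split by K^2 = 1 into even and odd parts; commutation with K is then
    immediate. *)
Lemma lorentz_boostE chi :
  lorentz_boost chi = (cosh chi)%:M + sinh chi *: boost.
Proof.
by apply: mx2P => j; case: (ord2P j) => ->;
  rewrite !mxE /= ?mulr1 ?mulr0 ?addr0 ?add0r.
Qed.

Lemma boost_comm chi : boost *m lorentz_boost chi = lorentz_boost chi *m boost.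
Proof.
by rewrite lorentz_boostE mulmxDl mulmxDr mul_scalar_mx mul_mx_scalar
  -scalemxAl -scalemxAr.
Qed.

Lemma lorentz_boostN chi : lorentz_boost chi *m lorentz_boost (- chi) = 1%:M.
Proof.
have h := cosh2Bsinh2 chi.
by apply: mx2P => j; case: (ord2P j) => ->;
  rewrite !mxE sum_ord2 !mxE /= ?coshN ?sinhN; rewrite -?h; ring.
Qed.

Lemma invmx_frame k chi : k != 0 ->
  invmx (k^-1 *: lorentz_boost chi) = k *: lorentz_boost (- chi).
Proof.
move=> k0; apply: invmx_eq.
by rewrite -scalemxAl -scalemxAr scalerA mulVf // scale1r lorentz_boostN.
Qed.

Lemma minkowskiE (i j : 'I_2) :
  minkowski_form i j = (if i == j then if i == 0 then -1 else 1 else 0) :> R.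
Proof. by rewrite !mxE; case: (i == j); rewrite ?mulr1n ?mulr0n. Qed.

(** The factor [k] lets one formula serve the Minkowski form (k = 1) and the conformal metric (k =
    Omega^2). *)
Lemma minkowski_pullbackE k B i j :
  (B^T *m (k *: minkowski_form) *m B) i j = k * (B 1 i * B 1 j - B 0 i * B 0 j).
Proof.
rewrite !mxE sum_ord2 !mxE !sum_ord2 !mxE /= ?mulr1n ?mulr0n.
by ring.
Qed.

Lemma bilin_minkowskiE k X Y :
  bilin (k *: minkowski_form) X Y = k * (X 1 0 * Y 1 0 - X 0 0 * Y 0 0).
Proof.
rewrite /bilin !mxE sum_ord2 !mxE !sum_ord2 !mxE /= ?mulr1n ?mulr0n.
by ring.
Qed.

Lemma det_lorentz_boost chi : \det (lorentz_boost chi) = 1.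
Proof. by rewrite det_mx2 !mxE /= -(cosh2Bsinh2 chi) !expr2. Qed.

(** The first column sums to e^chi, which determines chi. *)
Lemma lorentz_boost_inj : injective lorentz_boost.
Proof.
move=> a b /matrixP ab; apply: expR_inj.
by have := ab 0 0; have := ab 1 0; rewrite !mxE /= -!coshDsinh => -> ->.
Qed.

Lemma lorentz_boost_pullback chi :
  (lorentz_boost chi)^T *m minkowski_form *m lorentz_boost chi = minkowski_form.
Proof.
have h := cosh2Bsinh2 chi; rewrite -[in LHS](scale1r minkowski_form).
by apply: mx2P => j; case: (ord2P j) => ->;
  rewrite minkowski_pullbackE minkowskiE !mxE /=; nra.
Qed.

(* Orthogonality of the columns and det L > 0 force the second column to be
   (L 1 0, L 0 0), and the parameter is ln (L 0 0 + L 1 0), as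
   cosh chi + sinh chi = e^chi. *)
Lemma lorentz_boostP L : L^T *m minkowski_form *m L = minkowski_form ->
  0 < \det L -> 0 < L 0 0 -> exists chi, L = lorentz_boost chi.
Proof.
rewrite -{1}(scale1r minkowski_form) => /matrixP LP.
have := LP 1 1; have := LP 0 1; have := LP 0 0.
rewrite !minkowski_pullbackE !minkowskiE det_mx2 /= !mul1r.
set a := L 0 0; set b := L 0 1; set c := L 1 0; set d := L 1 1.
move=> e00 e01 e11 det0 a0.
have ab : a * b = c * d by lra.
have ac1 : a * a - c * c = 1 by lra.
(* With D the determinant, the second column (b, d) is D (c, a): substitute ab = cd, then a^2 - c^2
   = 1. *)
have dE : d = (a * d - b * c) * a.
  have -> : (a * d - b * c) * a = a * a * d - c * (a * b) by ring.
  by rewrite ab; transitivity ((a * a - c * c) * d); [rewrite ac1 mul1r|ring].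
have bE : b = (a * d - b * c) * c.
  have -> : (a * d - b * c) * c = a * (c * d) - c * c * b by ring.
  by rewrite -ab; transitivity ((a * a - c * c) * b); [rewrite ac1 mul1r|ring].
(* The second column gives 1 = d^2 - b^2 = D^2 (a^2 - c^2) = D^2, and D > 0. *)
have det1 : a * d - b * c = 1.
  move: det0 dE bE; move: (a * d - b * c) => D D0 dE bE.
  have D2 : D * D = 1.
    rewrite -[LHS]mulr1 -ac1.
    by transitivity (d * d - b * b); [rewrite dE bE; ring|lra].
  by nra.
rewrite det1 !mul1r in dE bE.
have ac : 0 < a + c by nra.
exists (ln (a + c)).
have eP : expR (ln (a + c)) = a + c by rewrite lnK.
(* Since (a + c)(a - c) = 1, half the sum and half the difference of e^chi and e^(-chi) return a and
   c. *)
have eN : expR (- ln (a + c)) = a - c.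
  rewrite expRN eP; apply: (mulfI (lt0r_neq0 ac)).
  by rewrite mulfV ?lt0r_neq0 //; nra.
by apply: mx2P => j; case: (ord2P j) => ->;
  rewrite !mxE /= /cosh /sinh eP eN -/a -/b -/c -/d ?dE ?bE; field.
Qed.

(** Timelike vectors (a, b) and (s, t) satisfy |bt| < |as|, so the sign of bt - as is that of -as; a
    negative product with s > 0 forces a > 0. *)
Lemma future_gt0 (a b s t : R) :
  b ^+ 2 < a ^+ 2 -> t ^+ 2 < s ^+ 2 -> 0 < s -> b * t < a * s -> 0 < a.
Proof.
move=> ab st s0 H; rewrite ltNge; apply/negP => a0.
have : `|b| * `|t| < `|a| * `|s|.
  by apply: ltr_pM => //; rewrite -ltr_sqr ?nnegrE // !real_normK ?num_real.
rewrite -!normrM (ler0_norm (_ : a * s <= 0)); last by nra.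
have := ler_norm (- (b * t)); rewrite normrN; lra.
Qed.

End LorentzBoost.

(** * Orthonormal frames of a conformal metric and their boost parameter *)

Section ConformalChart.
Context {R : realType} (M : lorentzSurface R) (c : chart R M).
Variable Omega : 'cV[R]_2 -> R.
Hypothesis hc : local_coordinates c.
Hypothesis hOmega : smooth_on (cimage c) Omega.
Hypothesis Omega_gt0 : forall x, cimage c x -> 0 < Omega x.
Hypothesis hmetric : forall x, cimage c x ->
  metric c x = Omega x ^+ 2 *: minkowski_form.
Implicit Types (x : 'cV[R]_2) (chi : R) (X : 'cV[R]_2 * R^o).

Lemma frame_coordE x chi :
  frame_coord Omega (x, chi) = (x, (Omega x)^-1 *: lorentz_boost chi).
Proof. by []. Qed.

(** Moves the conformal factor into the frame: B is orthonormal exactly when Omega B is a Minkowski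
    isometry. *)
Lemma conformal_frame_pullback x (B : 'M[R]_2) : cimage c x ->
  B^T *m metric c x *m B =
  (Omega x *: B)^T *m minkowski_form *m (Omega x *: B).
Proof.
move=> cx; rewrite hmetric //.
rewrite [(Omega x *: B)^T]linearZ /= -!scalemxAr -!scalemxAl.
by rewrite scalerA -expr2.
Qed.

Section Bijection.
Hypothesis hfuture : forall x, cimage c x -> future_timelike c x (delta_mx 0 0).
Hypothesis horiented : forall x, cimage c x -> positively_oriented c x 1%:M.

Lemma area_gt0 x : cimage c x -> 0 < area c x.
Proof. by move=> /horiented; rewrite /positively_oriented det1 mulr1. Qed.

(** The product of d/dv with the time orientation is -Omega^2 times this component, and d/dv is
    future-directed. *)
Lemma time_component_gt0 x : cimage c x -> 0 < time c x 0 0.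
Proof.
move=> cx; have [_] := hfuture cx; have := Omega_gt0 cx.
by rewrite hmetric // bilin_minkowskiE !mxE /=; nra.
Qed.

Lemma time_component_sq x : cimage c x -> time c x 1 0 ^+ 2 < time c x 0 0 ^+ 2.
Proof.
move=> cx; have := time_timelike hc cx; have := Omega_gt0 cx => O0.
rewrite hmetric // bilin_minkowskiE pmulr_rlt0 ?exprn_gt0 //.
by rewrite subr_lt0 !expr2.
Qed.

(** Orthonormality already makes the first column timelike, so only the sign of its product with
    [time] remains, and this is decided by the leading components. *)
Lemma future_conformal x (B : 'M[R]_2) : cimage c x ->
    B^T *m metric c x *m B = minkowski_form ->
  future_timelike c x (col 0 B) <-> 0 < B 0 0.
Proof.
move=> cx; have O0 := Omega_gt0 cx.
have O2 : 0 < Omega x ^+ 2 by rewrite exprn_gt0.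
have t0 := time_component_gt0 cx; have t2 := time_component_sq cx.
move=> /matrixP/(_ 0 0); rewrite /future_timelike hmetric //.
rewrite minkowski_pullbackE minkowskiE /= !bilin_minkowskiE !mxE => B00.
have Blt : B 1 0 ^+ 2 < B 0 0 ^+ 2.
  by rewrite -subr_lt0 -(pmulr_rlt0 _ O2) !expr2 B00 ltrN10.
rewrite B00 pmulr_rlt0 // subr_lt0; split=> [[_ H]|b0].
  exact: future_gt0 H.
split; first by rewrite ltrN10.
apply: le_lt_trans (ler_norm _) _; rewrite normrM.
rewrite -(gtr0_norm b0) -(gtr0_norm t0).
by apply: ltr_pM => //; rewrite -ltr_sqr ?nnegrE // !real_normK ?num_real.
Qed.

Lemma frame_coord_bij :
  set_bij (cimage c `*` [set: R^o]) (frame_bundle c) (frame_coord Omega).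
Proof.
split.
- move=> [x chi] [/= cx _]; rewrite frame_coordE.
  have O0 := Omega_gt0 cx; have On := lt0r_neq0 O0.
  have fr : ((Omega x)^-1 *: lorentz_boost chi)^T *m metric c x
      *m ((Omega x)^-1 *: lorentz_boost chi) = minkowski_form.
    by rewrite conformal_frame_pullback // scalerA mulfV // scale1r
       lorentz_boost_pullback.
  split => //=.
  + rewrite /positively_oriented detZ det_lorentz_boost mulr1.
    by rewrite mulr_gt0 ?area_gt0 // exprn_gt0 // invr_gt0.
  + apply/(future_conformal cx fr).
    by rewrite !mxE /= mulr_gt0 ?invr_gt0 ?cosh_gt0.
- move=> [x chi] [y psi]; rewrite !inE => -[/= cx _] [/= cy _] [] xy.
  rewrite -{}xy in cy *; move=> /(scalerI _) H.
  by rewrite (lorentz_boost_inj (H _)) // invr_eq0 lt0r_neq0 // Omega_gt0.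
(* Surjectivity: the three defining conditions of a frame become the three hypotheses of
   [lorentz_boostP] for Omega B. *)
- move=> [x B] [/= cx fr posB fut]; have O0 := Omega_gt0 cx.
  have [chi Bchi] : exists chi, Omega x *: B = lorentz_boost chi.
    apply: lorentz_boostP; first by rewrite -conformal_frame_pullback.
      rewrite detZ mulr_gt0 ?exprn_gt0 //.
      by move: posB; rewrite /positively_oriented pmulr_rgt0 // area_gt0.
    by rewrite mxE mulr_gt0 //; apply/(future_conformal cx fr).
  exists (x, chi) => //; rewrite frame_coordE -Bchi scalerA mulVf ?scale1r //.
  exact: lt0r_neq0.
Qed.

End Bijection.

(** * The differential of the frame coordinates *)

Lemma tangent_base x chi X :
  (tangent_map (frame_coord Omega) (x, chi) X).1 = X.1.
Proof. by apply/matrixP => i j; rewrite ord1 !mxE; exact: derive_entry. Qed.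

Definition dOmega x (v : 'cV[R]_2) : R :=
  v 0 0 * partial 0 Omega x + v 1 0 * partial 1 Omega x.

(** Smoothness at the empty list of partial derivatives is differentiability of Omega itself. *)
Lemma derivable_Omega x v : cimage c x -> derivable (Omega : _ -> R^o) x v.
Proof. by move=> cx; apply: diff_derivable; exact: (hOmega [::] cx). Qed.

Lemma derive_Omega x v : cimage c x -> 'D_v (Omega : _ -> R^o) x = dOmega x v.
Proof. by move=> cx; apply: derive_partial; exact: (hOmega [::] cx). Qed.

(** Product and chain rule for f(chi) / Omega, done once for both the cosh and the sinh entries. *)
Lemma derive_frame_entry x chi X (f : R -> R) (df : R) : cimage c x ->
  is_derive chi 1 f df ->
  'D_X (fun p : 'cV[R]_2 * R^o => (Omega p.1)^-1 * f p.2 : R^o) (x, chi) =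
  (Omega x)^-1 * (X.2 * df - (Omega x)^-1 * dOmega x X.1 * f chi).
Proof.
move=> cx fdf; have On := lt0r_neq0 (Omega_gt0 cx).
have dO := @derivable_Omega x X.1 cx.
have diff_f : differentiable (f : R^o -> R^o) chi by apply/derivable1_diffP.
have dVO : derivable (fun p : 'cV[R]_2 * R^o => (Omega p.1)^-1 : R^o)
    (x, chi) X.
  apply: (derivable_comp_fst (f := fun y => (Omega y)^-1 : R^o)).
  exact: derivableV.
have dF : derivable (fun p : 'cV[R]_2 * R^o => f p.2 : R^o) (x, chi) X.
  by apply: derivable_comp_snd; exact: diff_derivable.
have -> := deriveM dVO dF.
rewrite (derive_comp_fst (fun y => (Omega y)^-1 : R^o)) deriveV //=.
have -> : 'D_X (fun p : 'cV[R]_2 * R^o => f p.2 : R^o) (x, chi) = X.2 * df.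
  rewrite -[LHS]/('D_(X.2) (f : R^o -> R^o) chi) derive_scale //.
  by rewrite derive_val.
rewrite derive_Omega // /GRing.scale /=.
by field.
Qed.

Lemma tangent_frame x chi X : cimage c x ->
  (tangent_map (frame_coord Omega) (x, chi) X).2 =
  ((X.2 : R) *: boost - ((Omega x)^-1 * dOmega x X.1)%:M)
    *m ((Omega x)^-1 *: lorentz_boost chi).
Proof.
move=> cx.
have dC := derive_frame_entry X cx (is_derive_cosh chi).
have dS := derive_frame_entry X cx (is_derive_sinh chi).
have E i j : (fun p => (frame_coord Omega p).2 i j : R^o) =
    (fun p => (Omega p.1)^-1 * (if i == j then cosh else sinh) p.2).
  by apply/funext => p; rewrite !mxE; case: (i == j).
by apply: mx2P => j; case: (ord2P j) => ->;
  rewrite mxE E /= ?dC ?dS !mxE sum_ord2 !mxE /= ?mulr1n ?mulr0n; ring.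
Qed.

(** * The Levi-Civita connection of the conformal metric *)

Lemma partial_metric x (k i j : 'I_2) : cimage c x ->
  partial k (fun y => metric c y i j) x =
  2 * Omega x * partial k Omega x * minkowski_form i j.
Proof.
move=> cx; have dO := @derivable_Omega x (delta_mx k 0) cx.
rewrite /partial.
have -> : 'D_(delta_mx k 0) (fun y => metric c y i j : R^o) x =
  'D_(delta_mx k 0) (minkowski_form i j *: (Omega ^+ 2 : _ -> R^o)) x.
  (* The conformal formula is known only on the chart image; that set is open, so the two functions
     agree near x. *)
  apply: near_eq_derive; have : nbhs x (cimage c).
    by apply: open_nbhs_nbhs; split => //; exact: cimage_open.
  apply: filterS => y cy; rewrite hmetric // mxE mulrC.
  by rewrite /= !fctE.
rewrite deriveZ ?deriveX //; last exact: derivableX.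
by rewrite /GRing.scale /= expr1 mulrC -mulr_natl; ring.
Qed.

Lemma invmx_metric x : cimage c x ->
  invmx (metric c x) = (Omega x ^- 2) *: minkowski_form.
Proof.
move=> cx; have On := lt0r_neq0 (Omega_gt0 cx).
rewrite hmetric //; apply: invmx_eq.
by apply: mx2P => j; case: (ord2P j) => ->;
  rewrite !mxE sum_ord2 !mxE /= ?mulr1n ?mulr0n; field.
Qed.

Lemma christoffel_conformal x (v : 'cV[R]_2) : cimage c x ->
  \matrix_(k, j) (\sum_i christoffel c x k i j * v i 0) =
  ((Omega x)^-1 * dOmega x v)%:M + ((Omega x)^-1 *
    (partial 0 Omega x * v 1 0 + partial 1 Omega x * v 0 0)) *: boost.
Proof.
move=> cx; have On := lt0r_neq0 (Omega_gt0 cx).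
have P := partial_metric _ _ _ cx.
by apply: mx2P => j; case: (ord2P j) => ->;
  rewrite !mxE sum_ord2 /christoffel !sum_ord2 !P (invmx_metric cx) !mxE /=
    ?mulr1n ?mulr0n /dOmega; move: (Omega x) On (partial 0 Omega x)
    (partial 1 Omega x) (v 0 0) (v 1 0) => O On p q r s; field.
Qed.

(** Regroups the index formula as B^(-1) (dB + Gamma(dx) B), ready for the closed forms of dB and
    Gamma. *)
Lemma connectionE (u X : 'cV[R]_2 * 'M[R]_2) :
  connection c u X = invmx u.2 *m
    (X.2 + (\matrix_(k, j) (\sum_i christoffel c u.1 k i j * X.1 i 0)) *m u.2).
Proof.
apply/matrixP => a b; rewrite !mxE; apply: eq_bigr => k _.
rewrite !mxE mulrDr; congr (_ + _).
rewrite !sum_ord2 !mxE !sum_ord2; ring.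
Qed.

Lemma connection_conformal x chi X : cimage c x ->
  connection c (frame_coord Omega (x, chi))
    (tangent_map (frame_coord Omega) (x, chi) X) =
  (dchi X + (Omega x)^-1 *
    (partial 0 Omega x * dw X + partial 1 Omega x * dv X)) *: boost.
Proof.
move=> cx; have On := lt0r_neq0 (Omega_gt0 cx).
rewrite connectionE tangent_base tangent_frame // christoffel_conformal //=.
set a := (Omega x)^-1 * dOmega x X.1; set k := (Omega x)^-1 * _.
rewrite -mulmxDl.
(* The scalar d(ln Omega) cancels, leaving a value in so(1,1). *)
have -> : (X.2 : R) *: boost - a%:M + (a%:M + k *: boost) = (X.2 + k) *: boost.
  by rewrite addrA subrK scalerDl.
(* K is moved to the right of L, so that L^(-1) meets L. *)
rewrite -!scalemxAr -scalemxAl boost_comm invmx_frame //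
  -!scalemxAl -!scalemxAr.
rewrite mulmxA (mulmx1C (lorentz_boostN chi)) mul1mx !scalerA.
by congr (_ *: _); rewrite mulVf // mul1r.
Qed.

(** * The solder form and the Schmidt line element *)

Lemma solder_conformal x chi X : cimage c x ->
  solder (frame_coord Omega (x, chi))
    (tangent_map (frame_coord Omega) (x, chi) X) =
  (Omega x *: lorentz_boost (- chi)) *m X.1.
Proof.
move=> cx; rewrite /solder tangent_base /= invmx_frame ?lt0r_neq0 ?Omega_gt0 //.
by apply/matrixP => i j; rewrite ord1 !mxE.
Qed.

Lemma schmidt_boost (u U V : 'cV[R]_2 * 'M[R]_2) (tU tV : 'cV[R]_2) (a b : R) :
  solder u U = tU -> solder u V = tV ->
  connection c u U = a *: boost -> connection c u V = b *: boost ->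
  schmidt_metric c u U V = \sum_i tU i 0 * tV i 0 + a * b.
Proof. by move=> <- <- cU cV; rewrite /schmidt_metric cU cV lie_dotE. Qed.

Lemma schmidt_conformal x chi (X Y : 'cV[R]_2 * R^o) : cimage c x ->
  let A (Z : 'cV[R]_2 * R^o) := dchi Z + (Omega x)^-1 *
    (partial 0 Omega x * dw Z + partial 1 Omega x * dv Z) in
  pullback (frame_coord Omega) (schmidt_metric c) (x, chi) X Y =
    Omega x ^+ 2 *
      (cosh (2 * chi) * (sym_prod dv dv X Y + sym_prod dw dw X Y)
       - 2 * sinh (2 * chi) * sym_prod dv dw X Y)
    + sym_prod A A X Y.
Proof.
move=> cx A; rewrite /pullback.
rewrite (schmidt_boost (solder_conformal chi X cx) (solder_conformal chi Y cx)
  (connection_conformal chi X cx) (connection_conformal chi Y cx)).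
rewrite -/(A X) -/(A Y).
have -> : sym_prod A A X Y = A X * A Y.
  by rewrite /sym_prod; move: (A X) (A Y) => a b; field.
congr (_ + _).
(* The squares contribute cosh^2 + sinh^2 = cosh(2 chi), the mixed terms -2 cosh sinh = -sinh(2
   chi); the factor 2 on dv dw undoes the half in [sym_prod]. *)
rewrite sum_ord2 !mxE !sum_ord2 !mxE /= coshN sinhN cosh_double sinh_double.
rewrite /sym_prod /dv /dw; move: (cosh chi) (sinh chi) (Omega x) => ch sh O.
move: (X.1 0 0) (X.1 1 0) (Y.1 0 0) (Y.1 1 0) => X0 X1 Y0 Y1.
by field.
Qed.

End ConformalChart.

Unset Implicit Arguments.

Theorem mainTheorem2 (R : realType) (M : lorentzSurface R) (c : chart R M)
  (Omega : 'cV[R]_2 -> R)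
  (hc : local_coordinates c)
  (hOmega : smooth_on (cimage c) Omega)
  (hOmega_gt0 : forall x, cimage c x -> 0 < Omega x)
  (hmetric : forall x, cimage c x ->
    metric c x = Omega x ^+ 2 *: minkowski_form)
  (hfuture : forall x, cimage c x -> future_timelike c x (delta_mx 0 0))
  (horiented : forall x, cimage c x -> positively_oriented c x 1%:M) :
  set_bij (cimage c `*` [set: R^o]) (frame_bundle c) (frame_coord Omega) /\
  forall (x : 'cV[R]_2) (chi : R) (X Y : 'cV[R]_2 * R^o), cimage c x ->
    let A (Z : 'cV[R]_2 * R^o) := dchi Z + (Omega x)^-1 *
      (partial 0 Omega x * dw Z + partial 1 Omega x * dv Z) in
    pullback (frame_coord Omega) (schmidt_metric c) (x, chi) X Y =
      Omega x ^+ 2 *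
        (cosh (2 * chi) * (sym_prod dv dv X Y + sym_prod dw dw X Y)
         - 2 * sinh (2 * chi) * sym_prod dv dw X Y)
      + sym_prod A A X Y.
Proof.
split; first exact: frame_coord_bij.
by move=> x chi X Y cx; exact: schmidt_conformal.
Qed.
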